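(* Let $p,q$ be odd primes such that $p\equiv -1\pmod q$, and let $x^2+\xi x+1$ be an irreducible polynomial over $\mathbb{Z}_p$ such that its companion matrix $F=\begin{bmatrix}0&-1\\ 1&-\xi\end{bmatrix}$ has order $q$. Up to isomorphism, there exists a unique left brace with additive group isomorphic to $\mathbb{Z}_p^2\times\mathbb{Z}_q$ and with $|\ker\lambda|=p^2$. It is given by $(B,+,\circ)$ with $B=\mathbb{Z}_p\times\mathbb{Z}_p\times\mathbb{Z}_q$ and $$\begin{pmatrix} x_1\\ x_2\\ x_3\end{pmatrix}+\begin{pmatrix} y_1\\ y_2\\ y_3\end{pmatrix}=\begin{pmatrix} x_1+y_1\\ x_2+y_2\\ x_3+y_3\end{pmatrix},\qquad \begin{pmatrix} x_1\\ x_2\\ x_3\end{pmatrix}\circ\begin{pmatrix} y_1\\ y_2\\ y_3\end{pmatrix}=\begin{pmatrix}\begin{pmatrix}x_1\\ x_2\end{pmatrix}+F^{x_3}\begin{pmatrix} y_1\\ y_2\end{pmatrix}\\ x_3+y_3\end{pmatrix}$$ for all $x_1,x_2,y_1,y_2\in\mathbb{Z}_p$ and $x_3,y_3\in\mathbb{Z}_q$. In particular, $(B,\circ)\cong\mathcal{G}_F$ and $B$ is a bi-skew brace.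
   Context: A skew (left) brace is a triple $(B,+,\circ)$ where $(B,+)$ and $(B,\circ)$ are groups such that $a\circ(b+c)=a\circ b-a+a\circ c$ for all $a,b,c\in B$; it is a left brace if $(B,+)$ is abelian, and a bi-skew brace if $(B,\circ,+)$ is also a skew brace. The map $\lambda:(B,\circ)\to\mathrm{Aut}(B,+)$, $\lambda_a(b)=-a+a\circ b$, is a group homomorphism, with kernel $\ker\lambda$. Isomorphisms are bijections preserving both operations. $\mathcal{G}_F=\langle\sigma,\tau,\epsilon\mid\sigma^p=\tau^p=\epsilon^q=1,\ [\sigma,\tau]=1,\ \epsilon\sigma\epsilon^{-1}=\tau,\ \epsilon\tau\epsilon^{-1}=\sigma^{-1}\tau^{-\xi}\rangle\cong\mathbb{Z}_p^2\rtimes_F\mathbb{Z}_q$. *)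

(* Defs.v *)
From mathcomp Require Import all_boot all_order all_fingroup all_algebra.
From mathcomp Require Import boolp.
From mathcomp Require Import generic_quotient.
Set Implicit Arguments.
Unset Strict Implicit.
Unset Printing Implicit Defensive.
Import GRing.Theory.
Local Open Scope ring_scope.
Local Open Scope quotient_scope.

(* A brace carries two group structures on one type, so group structures are
   values here, rather than instances attached to the type. *)
Record group_law (T : Type) := GroupLaw {
  gop : T -> T -> T;
  gid : T;
  ginv : T -> T;
  gopA : associative gop;
  gid_l : left_id gid gop;
  gid_r : right_id gid gop;
  ginv_l : left_inverse gid ginv gop;
  ginv_r : right_inverse gid ginv gop
}.

Definition zmod_law (V : zmodType) : group_law V :=
  GroupLaw (@addrA V) (@add0r V) (@addr0 V) (@addNr V) (@addrN V).

Definition group_iso (S T : Type) (G : group_law S) (H : group_law T) : Prop :=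
  exists2 f : S -> T, bijective f & {morph f : x y / gop G x y >-> gop H x y}.

Definition brace_axiom (T : Type) (A C : group_law T) : Prop :=
  forall a b c : T,
    gop C a (gop A b c) = gop A (gop A (gop C a b) (ginv A a)) (gop C a c).

Record skew_brace (T : Type) := SkewBrace {
  sb_add : group_law T;
  sb_circ : group_law T;
  sb_axiom : brace_axiom sb_add sb_circ
}.

Definition left_brace (T : Type) (B : skew_brace T) : Prop :=
  commutative (gop (sb_add B)).

Definition bi_skew_brace (T : Type) (B : skew_brace T) : Prop :=
  brace_axiom (sb_circ B) (sb_add B).

Definition brace_iso (S T : Type) (B : skew_brace S) (B' : skew_brace T) :
    Prop :=
  exists f : S -> T, [/\ bijective f,
    {morph f : x y / gop (sb_add B) x y >-> gop (sb_add B') x y} &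
    {morph f : x y / gop (sb_circ B) x y >-> gop (sb_circ B') x y}].

Definition sb_lambda (T : Type) (B : skew_brace T) (a b : T) : T :=
  gop (sb_add B) (ginv (sb_add B) a) (gop (sb_circ B) a b).

Definition ker_lambda (T : finType) (B : skew_brace T) : {set T} :=
  [set a | [forall b, sb_lambda B a b == b]].

(* Words over X: (x, false) stands for x and (x, true) for its inverse. *)
Definition word (X : Type) := seq (X * bool).
Definition wgen (X : Type) (x : X) : word X := [:: (x, false)].
Definition winv (X : Type) (w : word X) : word X :=
  rev [seq (l.1, ~~ l.2) | l <- w].
Definition wpow (X : Type) (w : word X) (n : nat) : word X :=
  flatten (nseq n w).

(* The least congruence on words that cancels adjacent inverse letters and
   identifies the two sides of each relation in R. *)
Inductive wcong (X : eqType) (R : seq (word X * word X)) :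
    word X -> word X -> Prop :=
| wcong_refl u : wcong R u u
| wcong_sym u v : wcong R u v -> wcong R v u
| wcong_trans u v w : wcong R u v -> wcong R v w -> wcong R u w
| wcong_cat u u' v v' :
    wcong R u u' -> wcong R v v' -> wcong R (u ++ v) (u' ++ v')
| wcong_cancel x b : wcong R [:: (x, b); (x, ~~ b)] [::]
| wcong_rel u v : (u, v) \in R -> wcong R u v.

Section Presented.
Variables (X : choiceType) (R : seq (word X * word X)).

Definition wcongb : rel (word X) := fun u v => `[< wcong R u v >].

Lemma wcongb_refl : reflexive wcongb.
Proof. by move=> u; apply/asboolP; exact: wcong_refl. Qed.

Lemma wcongb_sym : symmetric wcongb.
Proof.
by move=> u v; apply/idP/idP => /asboolP h; apply/asboolP; exact: wcong_sym.
Qed.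

Lemma wcongb_trans : transitive wcongb.
Proof.
move=> v u w /asboolP huv /asboolP hvw; apply/asboolP.
exact: wcong_trans huv hvw.
Qed.

Canonical wcongb_equiv := EquivRel wcongb wcongb_refl wcongb_sym wcongb_trans.

Definition presented := {eq_quot wcongb}.

Lemma presentedP (u v : word X) :
  \pi_presented u = \pi_presented v <-> wcong R u v.
Proof.
split; first by move/eqmodP => /asboolP.
by move=> h; apply/eqmodP/asboolP.
Qed.

Lemma winvK : involutive (@winv X).
Proof.
move=> w; rewrite /winv map_rev revK -map_comp -[RHS]map_id.
by apply: eq_map => -[x b] /=; rewrite negbK.
Qed.

Lemma winv_r (w : word X) : wcong R (w ++ winv w) [::].
Proof.
elim: w => [|[x b] w IH]; first exact: wcong_refl.
have -> : ((x, b) :: w) ++ winv ((x, b) :: w) =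
    [:: (x, b)] ++ (w ++ winv w) ++ [:: (x, ~~ b)].
  by rewrite /winv /= rev_cons -cats1 !catA.
apply: wcong_trans (wcong_cancel R x b).
rewrite -[[:: (x, b); _]]/([:: (x, b)] ++ ([::] ++ [:: (x, ~~ b)])).
apply: wcong_cat; first exact: wcong_refl.
by apply: wcong_cat; last exact: wcong_refl.
Qed.

Lemma winv_l (w : word X) : wcong R (winv w ++ w) [::].
Proof. by rewrite -{2}[w]winvK; exact: winv_r. Qed.

Definition presented_mul (a b : presented) : presented :=
  \pi_presented (repr a ++ repr b).
Definition presented_one : presented := \pi_presented [::].
Definition presented_inv (a : presented) : presented :=
  \pi_presented (winv (repr a)).

Lemma wcong_repr (u : word X) : wcong R (repr (\pi_presented u)) u.
Proof. by apply/presentedP; rewrite reprK. Qed.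

Lemma pi_mul (u v : word X) :
  presented_mul (\pi_presented u) (\pi_presented v) = \pi_presented (u ++ v).
Proof. by apply/presentedP; apply: wcong_cat; exact: wcong_repr. Qed.

Lemma presented_mulA : associative presented_mul.
Proof.
elim/quotW => a; elim/quotW => b; elim/quotW => c.
by rewrite (pi_mul b c) (pi_mul a (b ++ c)) (pi_mul a b) (pi_mul (a ++ b) c) catA.
Qed.

Lemma presented_mul1 : left_id presented_one presented_mul.
Proof. by elim/quotW => a; rewrite pi_mul. Qed.

Lemma presented_mulr1 : right_id presented_one presented_mul.
Proof. by elim/quotW => a; rewrite pi_mul cats0. Qed.

Lemma presented_mulV : left_inverse presented_one presented_inv presented_mul.
Proof.
by move=> a; rewrite -{2}[a]reprK pi_mul; apply/presentedP; exact: winv_l.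
Qed.

Lemma presented_mulrV :
  right_inverse presented_one presented_inv presented_mul.
Proof.
by move=> a; rewrite -{1}[a]reprK pi_mul; apply/presentedP; exact: winv_r.
Qed.

Definition presented_law : group_law presented :=
  GroupLaw presented_mulA presented_mul1 presented_mulr1 presented_mulV
           presented_mulrV.

End Presented.

Definition Fmx (p : nat) (xi : 'F_p) : 'M['F_p]_2 :=
  \matrix_(i, j) if i == 0 then (if j == 0 then 0 else -1)
                 else (if j == 0 then 1 else - xi).

Lemma Fmx_unit (p : nat) (xi : 'F_p) : Fmx xi \is a GRing.unit.
Proof.
rewrite -[_ \is a _]/(Fmx xi \in unitmx) unitmxE.
by rewrite (expand_det_row _ 0) !big_ord_recl big_ord0 /cofactor !det_mx11
  !mxE /= mul0r add0r addr0 expr1 mulr1 mulN1r opprK unitr1.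
Qed.

Definition F_GL (p : nat) (xi : 'F_p) : {'GL_2['F_p]} :=
  FinRing.Unit (Fmx_unit xi).

Definition sigma : 'I_3 := @Ordinal 3 0 isT.
Definition tau : 'I_3 := @Ordinal 3 1 isT.
Definition eps : 'I_3 := @Ordinal 3 2 isT.

(* The exponent xi is read through the representative of xi in {0, ..., p-1};
   since tau ^ p = 1 the choice is immaterial. *)
Definition GF_rels (p q : nat) (xi : 'F_p) : seq (word 'I_3 * word 'I_3) :=
  let s := wgen sigma in let t := wgen tau in let e := wgen eps in
  [:: (wpow s p, [::]); (wpow t p, [::]); (wpow e q, [::]);
      (s ++ t ++ winv s ++ winv t, [::]);
      (e ++ s ++ winv e, t);
      (e ++ t ++ winv e, winv s ++ winv (wpow t xi))].

Definition GF_law (p q : nat) (xi : 'F_p) :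
    group_law (presented (GF_rels q xi)) :=
  presented_law (GF_rels q xi).

Definition BF (p q : nat) : finType := ('F_p * 'F_p * 'F_q)%type.

Definition col2 (R : Type) (a b : R) : 'cV[R]_2 :=
  \col_(i < 2) if i == 0 then a else b.

Definition BF_add (p q : nat) (x y : BF p q) : BF p q :=
  let: (x1, x2, x3) := x in let: (y1, y2, y3) := y in
  (x1 + y1, x2 + y2, x3 + y3).

(* F ^+ x3 uses the representative of x3 in {0, ..., q-1}. *)
Definition BF_circ (p q : nat) (xi : 'F_p) (x y : BF p q) : BF p q :=
  let: (x1, x2, x3) := x in let: (y1, y2, y3) := y in
  let v : 'cV['F_p]_2 := col2 x1 x2 + (Fmx xi ^+ x3) *m col2 y1 y2 in
  (v 0 0, v 1 0, x3 + y3).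

(* Main.v *)
From HB Require Import structures.
Require Import Defs.
From mathcomp Require Import all_boot all_order all_fingroup all_algebra.
From mathcomp Require Import cyclic generic_quotient ring zify.
Set Implicit Arguments.
Unset Strict Implicit.
Unset Printing Implicit Defensive.
Import GRing.Theory.
Local Open Scope ring_scope.

(* Write V = Z_p^2. Since |ker lambda| = p^2 is prime to q, ker lambda = V, so
   lambda factors through the third coordinate. It acts trivially on Z_q, by a
   fixed-point argument, hence (v, x) o (w, y) = (v + M^x w, x + y) for some
   M <> 1 in GL_2(p) with M^q = 1. Conjugating M into a power of F gives the
   isomorphism, so everything reduces to this: as q does not divide p - 1, M
   and the powers of F have determinant 1, and for such A of order q the sum
   1 + A + ... + A^(2m), m = (q - 1)/2, vanishes. It equals w(tr A) A^m for a
   monic polynomial w of degree m. The traces of F, ..., F^m are m distinct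
   roots of w, so tr M is one of them, and non-scalar 2 x 2 matrices with the
   same trace and determinant are conjugate. *)

(** * Two-by-two matrices over a field: similarity and power sums *)

Section Mx2.
Variable K : fieldType.
Implicit Types (a b c d : K) (A B : 'M[K]_2).

Definition mx2 a b c d : 'M[K]_2 :=
  \matrix_(i, j) if i == 0 then (if j == 0 then a else b)
                 else (if j == 0 then c else d).

Lemma mx2P (R : Type) (A B : 'M[R]_2) :
  A 0 0 = B 0 0 -> A 0 1 = B 0 1 -> A 1 0 = B 1 0 -> A 1 1 = B 1 1 -> A = B.
Proof.
move=> h00 h01 h10 h11.
have ord2 (i : 'I_2) : i = 0 \/ i = 1.
  by case: i => [[|[|//]] hi]; [left | right]; apply: val_inj.
by apply/matrixP => i j; case: (ord2 i) => ->; case: (ord2 j) => ->.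
Qed.

Lemma mx2E A : A = mx2 (A 0 0) (A 0 1) (A 1 0) (A 1 1).
Proof. by apply: mx2P; rewrite !mxE. Qed.

Lemma mul_mx2 a b c d a' b' c' d' :
  mx2 a b c d * mx2 a' b' c' d' =
  mx2 (a * a' + b * c') (a * b' + b * d') (c * a' + d * c') (c * b' + d * d').
Proof.
by apply: mx2P; rewrite mxE !big_ord_recl big_ord0 !mxE addr0.
Qed.

Lemma det_mx2 a b c d : \det (mx2 a b c d) = a * d - b * c.
Proof.
rewrite (expand_det_row _ 0) !big_ord_recl big_ord0 /cofactor !det_mx11 !mxE /=.
by ring.
Qed.

Lemma tr_mx2 a b c d : \tr (mx2 a b c d) = a + d.
Proof. by rewrite /mxtrace !big_ord_recl big_ord0 !mxE addr0. Qed.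

Lemma mx2_scalar a : a%:M = mx2 a 0 0 a.
Proof. by apply: mx2P; rewrite !mxE. Qed.

Lemma mx2_Cayley_Hamilton A : A * A = \tr A *: A - (\det A)%:M.
Proof.
rewrite [A]mx2E mul_mx2 det_mx2 tr_mx2 mx2_scalar.
by apply: mx2P; rewrite !mxE /=; ring.
Qed.

(** A non-scalar matrix has a vector w that is not an eigenvector. In the basis w, A w,
    Cayley-Hamilton makes its matrix the companion matrix. *)
Lemma mx2_companion A : ~~ is_scalar_mx A ->
  exists2 Q : 'M[K]_2, Q \in unitmx & A * Q = Q * mx2 0 (- \det A) 1 (\tr A).
Proof.
rewrite [A]mx2E.
move: (A 0 0 : K) (A 0 1 : K) (A 1 0 : K) (A 1 1 : K) => a b c d nsA.
(* For w = (x, y) the quantity is det(w | A w). A matrix with eigenvectors (1, 0), (0, 1) and (1, 1)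
   is scalar, so one of these three makes it nonzero. *)
have [x [y nz]] :
    exists x y : K, x * (c * x + d * y) - y * (a * x + b * y) != 0.
  have [c0|cN0] := eqVneq c 0; last first.
    by exists 1, 0; rewrite (_ : _ - _ = c) //; ring.
  have [b0|bN0] := eqVneq b 0; last first.
    by exists 0, 1; rewrite (_ : _ - _ = - b) ?oppr_eq0 //; ring.
  exists 1, 1; rewrite b0 c0 (_ : _ - _ = d - a); last by ring.
  apply: contraNneq nsA => /subr0_eq da.
  by apply/is_scalar_mxP; exists a; rewrite mx2_scalar b0 c0 da.
exists (mx2 x (a * x + b * y) y (c * x + d * y)).
  rewrite unitmxE det_mx2 unitfE; apply: contraNneq nz => e.
  by apply/eqP; rewrite -[RHS]e; ring.
by rewrite !mul_mx2 det_mx2 tr_mx2; congr mx2; ring.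
Qed.

(** Both matrices are conjugate to the same companion matrix, which trace and determinant
    determine. *)
Lemma mx2_similar A B : ~~ is_scalar_mx A -> ~~ is_scalar_mx B ->
    \tr A = \tr B -> \det A = \det B ->
  exists2 P : 'M[K]_2, P \in unitmx & P * A = B * P.
Proof.
move=> /mx2_companion[Q uQ eQ] /mx2_companion[R uR eR] etr edet.
exists (R * Q^-1); first by rewrite unitrMl ?unitrV.
apply: (mulIr (uQ : Q \is a GRing.unit)).
by rewrite -!mulrA eQ mulKr ?mulVr // mulr1 eR etr edet.
Qed.

(* Evaluated at x + x^-1 this is x^-m + ... + x^-1 + 1 + x + ... + x^m. *)
Fixpoint trpoly (m : nat) : {poly K} :=
  if m is n.+1 then
    (if n is k.+1 then 'X * trpoly n - trpoly k else 'X + 1)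
  else 1.

Lemma trpoly_rec m : trpoly m.+2 = 'X * trpoly m.+1 - trpoly m.
Proof. by []. Qed.

Lemma size_trpoly m : size (trpoly m) = m.+1.
Proof.
suff [] : size (trpoly m) = m.+1 /\ size (trpoly m.+1) = m.+2 by [].
elim: m => [|m [IH1 IH2]]; first by rewrite size_poly1 /= -polyC1 size_XaddC.
split=> //; have nz : trpoly m.+1 != 0 by rewrite -size_poly_eq0 IH2.
by rewrite trpoly_rec mulrC size_polyDl size_mulX ?IH2 // size_polyN IH1.
Qed.

(** For det A = 1, Cayley-Hamilton says that tr A acts as A + A^-1, which turns the recursion of
    [trpoly] into one for the power sums. It has two steps, so the induction carries two consecutive
    indices. *)
Lemma horner_trpoly m A : \det A = 1 ->
  (trpoly m).[\tr A] *: A ^+ m = \sum_(i < m.*2.+1) A ^+ i.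
Proof.
move=> d1; have CH : \tr A *: A = A * A + 1.
  by rewrite mx2_Cayley_Hamilton d1 subrK.
suff [] : (trpoly m).[\tr A] *: A ^+ m = \sum_(i < m.*2.+1) A ^+ i /\
  (trpoly m.+1).[\tr A] *: A ^+ m.+1 = \sum_(i < m.+1.*2.+1) A ^+ i by [].
elim: m => [|m [IH1 IH2]].
  rewrite 3!big_ord_recr !big_ord0 /= !add0r !hornerE !expr0 scale1r.
  split=> //.
  rewrite scalerDl scale1r expr1 CH big_ord1 expr0.
  apply: etrans (esym (addrA _ _ _)) _; apply: etrans (addrC _ _) _.
  by rewrite -expr2.
split=> //; rewrite trpoly_rec hornerD hornerN hornerM hornerX scalerDl scaleNr.
rewrite -scalerA {1}exprS scalerAr IH2 scalerAl CH mulrDl mul1r.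
rewrite [in A ^+ _](_ : m.+2 = (2 + m)%N) // exprD scalerAr IH1 -expr2.
have S2 n :
    \sum_(i < n.+2) A ^+ i = \sum_(i < n) A ^+ i + (A ^+ n + A ^+ n.+1).
  by rewrite 2!big_ord_recr /= addrA.
(* With S_n the sum of the first n powers, A^2 S_(2m+1) cancels in (A^2 + 1) S_(2m+3) - A^2
   S_(2m+1), leaving S_(2m+3) + A^(2m+3) + A^(2m+4). *)
rewrite !doubleS [RHS]S2 {1}S2 mulrDr addrAC (addrC (_ * _)) addrK addrC.
by rewrite mulrDr -!exprD.
Qed.

(** * Matrices with A^q = 1 over a field whose only q-th root of unity is 1 *)

Section RootsOfUnity.
Variable q : nat.
Hypotheses (q_odd : odd q) (qK : q%:R != 0 :> K).
Hypothesis rootK : forall c : K, c ^+ q = 1 -> c = 1.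

Lemma det_root1 A : A ^+ q = 1 -> \det A = 1.
Proof.
move=> Aq; apply: rootK.
have detX n : \det A ^+ n = \det (A ^+ n).
  by elim: n => [|n IH]; rewrite ?det1 // !exprS IH det_mulmx.
by rewrite detX Aq det1.
Qed.

(** If det(A - 1) = 0, then tr A = 2 and N = A - 1 satisfies A N = N, so A^n = 1 + n N. Now A^q = 1
    with q nonzero in K forces N = 0. *)
Lemma unit_root_sub1 A : A ^+ q = 1 -> A != 1 -> A - 1 \is a GRing.unit.
Proof.
move=> Aq; apply: contraR; rewrite -[_ \is a _]/(_ \in unitmx) unitmxE unitfE.
rewrite negbK => /eqP det0; have d1 := det_root1 Aq.
have t2 : \tr A = 2.
  suff e : \det (A - 1) = \det A - \tr A + 1.
    by apply/eqP; rewrite -subr_eq0 -oppr_eq0 -det0 e d1; apply/eqP; ring.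
  rewrite [A]mx2E -idmxE mx2_scalar.
  move: (A 0 0 : K) (A 0 1 : K) (A 1 0 : K) (A 1 1 : K) => a b c d.
  rewrite tr_mx2 det_mx2.
  rewrite (_ : _ - _ = mx2 (a - 1) b c (d - 1)) ?det_mx2; first by ring.
  by apply: mx2P; rewrite !mxE ?subr0.
have AN : A * (A - 1) = A - 1.
  rewrite mulrBr mulr1 mx2_Cayley_Hamilton d1 t2 scaler_nat mulr2n.
  by rewrite addrAC addrK.
have An n : A ^+ n = 1 + (A - 1) *+ n.
  elim: n => [|n IH]; first by rewrite addr0.
  by rewrite exprS IH mulrDr mulr1 mulrnAr AN mulrS addrA [1 + _]addrC subrK.
have: (A - 1) *+ q == 0 by rewrite -(addKr 1 (_ *+ q)) -An Aq addNr.
by rewrite -scaler_nat scaler_eq0 (negPf qK) subr_eq0.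
Qed.

Lemma root_not_scalar A : A ^+ q = 1 -> A != 1 -> ~~ is_scalar_mx A.
Proof.
move=> Aq; apply: contraNN => /is_scalar_mxP[a eA].
suff a1 : a = 1 by rewrite eA a1.
apply: rootK; move/matrixP/(_ 0 0): Aq; rewrite eA -rmorphXn.
by rewrite !mxE.
Qed.

(** The sum 1 + A + ... + A^(q-1) is annihilated by the unit A - 1, hence vanishes. It is also a
    scalar multiple of a unit, so the scalar is 0. *)
Lemma root_trpoly A : A ^+ q = 1 -> A != 1 -> root (trpoly q./2) (\tr A).
Proof.
move=> Aq A1; have uA : A \is a GRing.unit.
  by rewrite -(unitrX_pos _ (odd_gt0 q_odd)) Aq unitr1.
have sum0 : \sum_(i < q) A ^+ i = 0.
  by apply: (mulrI (unit_root_sub1 Aq A1)); rewrite -subrX1 Aq subrr mulr0.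
have := horner_trpoly q./2 (det_root1 Aq).
have -> : q./2.*2.+1 = q by rewrite -[RHS]odd_double_half q_odd.
rewrite sum0 => /eqP; rewrite scaler_eq0 => /orP[// | /eqP A0].
by move: (unitrX q./2 uA); rewrite A0 unitr0.
Qed.

(** Equal traces would mean B^i = B^j or B^i = B^-j, and both j - i and i + j lie strictly between 0
    and q. *)
Lemma tr_pow_inj B i j : (forall k, (0 < k < q)%N -> B ^+ k != 1) ->
    B ^+ q = 1 -> (i < j)%N -> (0 < i + j < q)%N ->
  \tr (B ^+ i) != \tr (B ^+ j).
Proof.
move=> Bk Bq lt_ij ij_q; apply/eqP => etr.
have detB n : \det (B ^+ n) = 1.
  by apply: det_root1; rewrite exprAC Bq expr1n.
have uB n : B ^+ n \is a GRing.unit.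
  by rewrite -[_ \is a _]/(_ \in unitmx) unitmxE detB unitr1.
have u1 n : (0 < n < q)%N -> B ^+ n - 1 \is a GRing.unit.
  by move=> n_q; apply: unit_root_sub1 (Bk _ n_q); rewrite exprAC Bq expr1n.
have CH n : B ^+ n * B ^+ n = \tr (B ^+ n) *: B ^+ n - 1.
  by rewrite mx2_Cayley_Hamilton detB.
(* X^2 = t X - 1 and Y^2 = t Y - 1 give (Y - X) (X Y - 1) = 0. *)
have : (B ^+ j - B ^+ i) * (B ^+ (i + j) - 1) = 0.
  have cXY : B ^+ j * B ^+ i = B ^+ i * B ^+ j by rewrite -!exprD addnC.
  rewrite exprD mulrBr mulr1 mulrBl (mulrA (B ^+ j)) cXY -mulrA.
  rewrite (mulrA (B ^+ i) (B ^+ i)).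
  rewrite !CH etr mulrBr mulr1 mulrBl mul1r -scalerAr -scalerAl.
  by apply/eqP; rewrite subr_eq0 opprB addrC subrKA.
have -> : B ^+ j - B ^+ i = B ^+ i * (B ^+ (j - i) - 1).
  by rewrite mulrBr mulr1 -exprD subnKC // ltnW.
move=> e0; suff : (0 : 'M[K]_2) \is a GRing.unit by rewrite unitr0.
by rewrite -e0 !unitrMl ?uB ?u1 //; lia.
Qed.

Lemma root_tr_pow A B : A ^+ q = 1 -> A != 1 ->
    B ^+ q = 1 -> (forall k, (0 < k < q)%N -> B ^+ k != 1) ->
  exists2 k, (0 < k < q)%N & \tr A = \tr (B ^+ k).
Proof.
move=> Aq A1 Bq Bk; pose s := [seq \tr (B ^+ i) | i <- iota 1 q./2].
have range_s i : i \in iota 1 q./2 -> (0 < i < q)%N.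
  by rewrite mem_iota; lia.
suff /mapP[k /range_s kq etr] : \tr A \in s by exists k.
apply: contraT => A_s.
have nz : trpoly q./2 != 0 by rewrite -size_poly_eq0 size_trpoly.
(* A trace outside [s] would give [q./2 + 1] distinct roots to a polynomial of degree [q./2].
   Distinct indices up to [q./2] sum to less than q, as [tr_pow_inj] requires. *)
suff : (size (\tr A :: s) < size (trpoly q./2))%N.
  by rewrite size_trpoly /= size_map size_iota ltnn.
apply: max_poly_roots nz _ _.
  rewrite /= root_trpoly //=; apply/allP => _ /mapP[i /range_s iq ->].
  by apply: root_trpoly; [rewrite exprAC Bq expr1n | exact: Bk].
rewrite /= A_s map_inj_in_uniq ?iota_uniq // => i j.
rewrite !mem_iota => hi hj etr; case: (ltngtP i j) => // ltij.
  by have /eqP[] := tr_pow_inj Bk Bq ltij ltac:(lia).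
by have /eqP[] := tr_pow_inj Bk Bq ltij ltac:(lia).
Qed.

Lemma root_conj_pow A B : A ^+ q = 1 -> A != 1 ->
    B ^+ q = 1 -> (forall k, (0 < k < q)%N -> B ^+ k != 1) ->
  exists2 k, (0 < k < q)%N &
    exists2 P : 'M[K]_2, P \in unitmx & P * A = B ^+ k * P.
Proof.
move=> Aq A1 Bq Bk; have [k kq etr] := root_tr_pow Aq A1 Bq Bk.
have Bkq : (B ^+ k) ^+ q = 1 by rewrite exprAC Bq expr1n.
exists k => //; apply: mx2_similar; rewrite ?root_not_scalar ?Bk //.
by rewrite !det_root1.
Qed.
End RootsOfUnity.
End Mx2.

(** * Elementary facts on group laws and their morphisms *)

Section GroupLaw.
Variables (T : Type) (G : group_law T).

Lemma gopI a : injective (gop G a).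
Proof.
move=> b c e; rewrite -[b](gid_l G) -(ginv_l G a) -gopA e.
by rewrite gopA ginv_l gid_l.
Qed.

Lemma gop_eql a b : gop G a b = b -> a = gid G.
Proof. by move=> e; rewrite -[a](gid_r G) -(ginv_r G b) gopA e. Qed.

Lemma ginv_unique a b : gop G a b = gid G -> b = ginv G a.
Proof. by rewrite -(ginv_r G a) => /gopI. Qed.

End GroupLaw.

Section GroupLawMorph.
Variables (S T : Type) (G : group_law S) (H : group_law T) (f : S -> T).
Hypothesis fM : {morph f : x y / gop G x y >-> gop H x y}.

Lemma morph_gid : f (gid G) = gid H.
Proof. by apply: gop_eql (_ : gop H _ (f (gid G)) = _); rewrite -fM gid_l. Qed.

Lemma morph_ginv a : f (ginv G a) = ginv H (f a).
Proof. by apply: ginv_unique; rewrite -fM ginv_r morph_gid. Qed.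

End GroupLawMorph.

(** The circle law is carried along [f] as well. The equality [sb_add C = A] lets the classification
    compute directly with the standard addition. *)
Lemma transport_brace (S T : finType) (B : skew_brace S) (A : group_law T)
    (f : S -> T) : bijective f ->
    {morph f : x y / gop (sb_add B) x y >-> gop A x y} ->
  exists2 C : skew_brace T, sb_add C = A &
    #|ker_lambda C| = #|ker_lambda B| /\ brace_iso B C.
Proof.
case=> g fK gK fD.
pose c x y := f (gop (sb_circ B) (g x) (g y)).
have cA : associative c by move=> x y z; rewrite /c !fK gopA.
have c1l : left_id (f (gid (sb_circ B))) c by move=> x; rewrite /c fK gid_l gK.
have c1r : right_id (f (gid (sb_circ B))) c by move=> x; rewrite /c fK gid_r gK.
pose ci x := f (ginv (sb_circ B) (g x)).
have cVl : left_inverse (f (gid (sb_circ B))) ci c.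
  by move=> x; rewrite /c fK ginv_l.
have cVr : right_inverse (f (gid (sb_circ B))) ci c.
  by move=> x; rewrite /c fK ginv_r.
pose CL := GroupLaw cA c1l c1r cVl cVr.
have ax : brace_axiom A CL.
  move=> x y z; rewrite /= /c -{1}[y]gK -{1}[z]gK -fD fK sb_axiom.
  by rewrite !fD (morph_ginv fD) gK.
pose C := SkewBrace ax; exists C => //.
(* As [f] intertwines the two lambda maps, it maps one kernel onto the other. *)
have lamE x y : sb_lambda C (f x) (f y) = f (sb_lambda B x y).
  by rewrite /sb_lambda /= /c !fK fD (morph_ginv fD).
split; last first.
  exists f; split=> //; first by exists g.
  by move=> x y; rewrite /= /c !fK.
rewrite -[RHS](card_imset _ (can_inj fK)).
suff -> : ker_lambda C = [set f x | x in ker_lambda B] by [].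
apply/setP => t; rewrite -(gK t) mem_imset ?inE; last exact: can_inj fK.
apply/forallP/forallP => h y.
  by rewrite -(inj_eq (can_inj fK)) -lamE h.
by rewrite -(gK y) lamE (inj_eq (can_inj fK)) h.
Qed.

(** * Pairs as column vectors *)

Section Vec.
Variable R : comNzRingType.
Implicit Types (u v : (R * R)%type) (M : 'M[R]_2).

Definition vec u : 'cV[R]_2 := col2 u.1 u.2.
Definition unvec (w : 'cV[R]_2) : (R * R)%type := (w 0 0, w 1 0).

Lemma vecK : cancel vec unvec.
Proof. by case=> a b; rewrite /unvec !mxE. Qed.

Lemma unvecK : cancel unvec vec.
Proof.
move=> w; apply/colP => i; rewrite !mxE.
by case: i => [[|[|//]] hi] /=; congr (w _ _); apply: val_inj.
Qed.

Lemma vecD : {morph vec : u v / u + v}.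
Proof. by move=> u v; apply/colP => i; rewrite !mxE; case: ifP. Qed.

Lemma unvecD : {morph unvec : u v / u + v}.
Proof. by move=> u v; rewrite /unvec !mxE. Qed.

Lemma mulmx_vec M u : M *m vec u =
  vec (M 0 0 * u.1 + M 0 1 * u.2, M 1 0 * u.1 + M 1 1 * u.2).
Proof.
apply/colP => i; rewrite !mxE !big_ord_recl big_ord0 !mxE addr0.
by case: i => [[|[|//]] hi] /=; congr (M _ _ * _ + M _ _ * _); apply: val_inj.
Qed.

Lemma mulmx_vec_inj M M' : (forall u, M *m vec u = M' *m vec u) -> M = M'.
Proof.
move=> h; have E u : unvec (M *m vec u) = unvec (M' *m vec u) by rewrite h.
have := E (0, 1); have := E (1, 0); rewrite !mulmx_vec !vecK /=.
rewrite !mulr1 !mulr0 !addr0 !add0r => -[e00 e10] [e01 e11].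
by apply: mx2P.
Qed.
End Vec.

(** * Exponents in Z_q: reduction mod q is harmless once x^q = 1 *)

Section FpExponent.
Variables (q : nat) (q_prime : prime q).

Lemma Fp_addE (a b : 'F_q) : a + b = ((a + b)%N)%:R.
Proof. by rewrite natrD !natr_Zp. Qed.

Variables (R : pzSemiRingType) (x : R).
Hypothesis xq : x ^+ q = 1.

Lemma expr_Fp_nat n : x ^+ (n%:R : 'F_q) = x ^+ n.
Proof. by rewrite val_Fp_nat ?expr_mod. Qed.

Lemma expr_FpD (a b : 'F_q) : x ^+ (a + b)%R = x ^+ a * x ^+ b.
Proof. by rewrite Fp_addE expr_Fp_nat exprD. Qed.

Lemma expr_FpM (a b : 'F_q) : x ^+ (a * b)%R = (x ^+ a) ^+ b.
Proof. by rewrite -exprM -(expr_Fp_nat (muln a b)) natrM !natr_Zp. Qed.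
End FpExponent.

Lemma pairMn (U V : nmodType) (u : U) (v : V) n :
  (u, v) *+ n = (u *+ n, v *+ n).
Proof. by elim: n => // n IH; rewrite !mulrS IH. Qed.

Lemma card_snd0 p q : prime p ->
  #|[set a : 'F_p * 'F_p * 'F_q | a.2 == 0]| = (p ^ 2)%N.
Proof.
move=> p_prime; have -> : [set a : 'F_p * 'F_p * 'F_q | a.2 == 0] =
    [set (v, 0) | v : 'F_p * 'F_p].
  apply/setP => -[v z]; rewrite !inE /=.
  by apply/eqP/imsetP => [->|[w _ [_ ->]] //]; exists v.
by rewrite card_imset ?card_prod ?card_Fp ?mulnn // => u v [].
Qed.

(** * The semidirect operation attached to a matrix *)

Section Semidirect.
Variables p q : nat.
Local Notation S := ('F_p * 'F_p * 'F_q)%type.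
Implicit Types (M N P : 'M['F_p]_2) (x y z : S).

(** The operation [BF_circ] with an arbitrary matrix in place of F. *)
Definition sdop M x y : S :=
  (unvec (vec x.1 + M ^+ x.2 *m vec y.1), x.2 + y.2).

Hypothesis q_prime : prime q.

(** The isomorphism is P on the plane and multiplication by k on Z_q, since P M^z = N^(k z) P. It is
    bijective because k is invertible mod q. *)
Lemma sdop_conj M N P k : M ^+ q = 1 -> N ^+ q = 1 ->
    (0 < k < q)%N -> P \in unitmx -> P * M = N ^+ k * P ->
  exists f : S -> S, [/\ bijective f, {morph f : x y / x + y} &
    {morph f : x y / sdop M x y >-> sdop N x y}].
Proof.
move=> Mq Nq kq uP ePM; pose c : 'F_q := k%:R.
have c0 : c != 0.
  rewrite -(dvdn_pcharf (pchar_Fp q_prime)); apply/negP => /dvdn_leq.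
  by lia.
pose f x : S := (unvec (P *m vec x.1), x.2 * c).
exists f; split.
- exists (fun x => (unvec (invmx P *m vec x.1), x.2 / c)) => [] [v z].
    by rewrite /= unvecK mulKmx // vecK mulfK.
  by rewrite /f /= unvecK mulKVmx // vecK divfK.
- by move=> x y; rewrite /f /= mulrDl vecD mulmxDr unvecD.
have ePMn n : P * M ^+ n = (N ^+ k) ^+ n * P.
  elim: n => [|n IH]; first by rewrite mulr1 mul1r.
  by rewrite !exprS mulrA ePM -mulrA IH mulrA.
move=> x y; rewrite /f /sdop /= mulrDl !unvecK mulmxDr.
congr (unvec (_ + _), _).
rewrite -[X in N ^+ X]/(nat_of_ord (x.2 * c)) mulrC expr_FpM // expr_Fp_nat //.
by rewrite !mulmxA; congr (_ *m _); exact: ePMn.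
Qed.

(** * Braces on Z_p^2 x Z_q with kernel of order p^2 are semidirect *)

Section Classify.
Hypothesis p_prime : prime p.
Variable B : skew_brace S.
Hypotheses (addE : sb_add B = zmod_law S) (cardK : #|ker_lambda B| = (p ^ 2)%N).
Hypothesis pq : coprime p q.

Let C := sb_circ B.
Let lam := sb_lambda B.

Let ginvE a : ginv (sb_add B) a = - a. Proof. by rewrite addE. Qed.
Let gopE a b : gop (sb_add B) a b = a + b. Proof. by rewrite addE. Qed.

Let circE a b : gop C a b = a + lam a b.
Proof. by rewrite /lam /sb_lambda gopE ginvE addrA subrr add0r. Qed.

Let lamD a : {morph lam a : b c / b + c}.
Proof.
move=> b c; have := sb_axiom B a b c; rewrite !gopE ginvE !circE.
by move=> e; apply: (addrI a); rewrite e (addrAC a) subrr add0r addrCA.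
Qed.

Let lam0 a : lam a 0 = 0.
Proof. by apply: (addrI (lam a 0)); rewrite -lamD !addr0. Qed.

Let lamMn a b n : lam a (b *+ n) = lam a b *+ n.
Proof. by elim: n => [|n IH]; rewrite ?lam0 // !mulrS lamD IH. Qed.

Let lamM a b c : lam (gop C a b) c = lam a (lam b c).
Proof.
apply: (addrI (gop C a b)); rewrite -circE -gopA !(circE a) !(circE b).
by rewrite lamD addrA.
Qed.

Let gid0 : gid C = 0.
Proof. by apply/esym/(@gop_eql _ C _ 0); rewrite circE lam0 addr0. Qed.

Let lam0l b : lam 0 b = b.
Proof. by rewrite -[LHS]add0r -circE -gid0 gid_l. Qed.

Let kerP a : reflect (forall b, lam a b = b) (a \in ker_lambda B).
Proof. by rewrite inE; apply: (iffP forallP) => h b; apply/eqP; exact: h. Qed.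

(** On the kernel the circle operation is addition, so the kernel is an additive subgroup. Its
    elements are killed by p^2, which is invertible mod q; hence their last coordinate is 0, and
    equality follows by counting. *)
Let kerE a : (a \in ker_lambda B) = (a.2 == 0).
Proof.
have gK : group_set (ker_lambda B).
  apply/group_setP; split; first by apply/kerP; exact: lam0l.
  move=> x y /kerP hx /kerP hy; apply/kerP => z.
  by rewrite -[(x * y)%g]/(x + y) -[y in x + y]hx -circE lamM hy hx.
have sub : ker_lambda B \subset [set a | a.2 == 0].
  apply/subsetP => b bK; have := expg_cardG (bK : b \in Group gK).
  rewrite /= cardK.
  have -> n : (b ^+ n)%g = b *+ n.
    by elim: n => [|n IH]; rewrite ?expg0 // expgS mulrS IH.
  move/(congr1 snd); rewrite raddfMn /= => /eqP.
  rewrite inE -mulr_natl mulf_eq0 -(dvdn_pcharf (pchar_Fp q_prime)).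
  rewrite Euclid_dvdX // andbT; case/orP => // qp.
  by move: pq; rewrite coprime_sym prime_coprime // qp.
have /eqP -> : ker_lambda B == [set a | a.2 == 0].
  by rewrite eqEcard sub cardK card_snd0 ?leqnn.
by rewrite inE.
Qed.

Let lam_torsion a b n : b *+ n = 0 -> lam a b *+ n = 0.
Proof. by rewrite -lamMn => ->; exact: lam0. Qed.

Let natr_neq0 n m : prime m -> coprime n m -> n%:R != 0 :> 'F_m.
Proof.
move=> m_prime nm; rewrite -(dvdn_pcharf (pchar_Fp m_prime)).
by rewrite -prime_coprime // coprime_sym.
Qed.

Let mulrnF m (z : 'F_m) : prime m -> z *+ m = 0.
Proof. by move=> m_prime; rewrite -mulr_natl pchar_Fp_0 // mul0r. Qed.

(** The map [lam a] is additive, so the image is killed by p, which is invertible mod q. [lam_snd]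
    is the same with p and q exchanged. *)
Let lam_fst a (v : 'F_p * 'F_p) : (lam a (v, 0)).2 = 0.
Proof.
have /(congr1 snd) : lam a (v, 0) *+ p = 0.
  apply: lam_torsion; case: v => v1 v2.
  by rewrite !pairMn !mulrnF // mul0rn.
rewrite raddfMn /= -mulr_natl => /eqP; rewrite mulf_eq0.
by rewrite (negPf (natr_neq0 q_prime pq)) => /eqP.
Qed.

Let lam_snd a (z : 'F_q) : (lam a (0, z)).1 = 0.
Proof.
have /(congr1 fst) : lam a (0, z) *+ q = 0.
  apply: lam_torsion.
  by rewrite !pairMn !mulrnF // mul0rn.
have qp : q%:R != 0 :> 'F_p by rewrite natr_neq0 // coprime_sym.
case: (lam a _) => -[v1 v2] w; rewrite !pairMn /= => /eqP.
rewrite xpair_eqE /= -(mulr_natl v1) -(mulr_natl v2) !mulf_eq0 (negPf qp) /=.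
by case/andP => /eqP -> /eqP ->.
Qed.

(** Since (v, 0) is in the kernel, (v, z) is the circle product of (v, 0) and (0, z), and only the
    second factor acts. *)
Let lam_split a b : lam a b = lam (0, a.2) b.
Proof.
have hv v c : lam (v, 0) c = c by apply/kerP; rewrite kerE.
case: a => v z /=; have -> : (v, z) = gop C (v, 0) (0, z).
  by rewrite circE hv; congr (_, _); rewrite ?addr0 ?add0r.
by rewrite lamM hv.
Qed.

Let pairE (v : 'F_p * 'F_p) (z : 'F_q) : (v, z) = (v, 0) + (0, z) :> S.
Proof. by congr (_, _); rewrite ?addr0 ?add0r. Qed.

Let Zact (x : 'F_q) := (lam (0, x) (0, 1)).2.

Let lam_Zact (x y : 'F_q) : lam (0, x) (0, y) = (0, Zact x * y).
Proof.
have -> : (0, y) = (0, 1) *+ y :> S by rewrite pairMn mul0rn natr_Zp.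
rewrite lamMn [lam _ _]surjective_pairing lam_snd pairMn mul0rn.
by rewrite -mulr_natr natr_Zp.
Qed.

(* A nontrivial action [y |-> c * y] of [x] would make [x / (1 - c)] a fixed
   point of [y |-> x o y = x + c * y], forcing [x = 0]. *)
Let Zact1 (x : 'F_q) : Zact x = 1.
Proof.
apply/eqP/contraT => c1; have nz : 1 - Zact x != 0 by rewrite subr_eq0 eq_sym.
pose y := x / (1 - Zact x).
have fix_y : gop C (0, x) (0, y) = (0, y).
  rewrite circE lam_Zact -[LHS]/(0 + 0, x + Zact x * y) addr0.
  by rewrite -{1}(divfK nz x) -/y mulrC mulrBl mul1r subrK.
have [x0] : (0, x) = 0 :> S by rewrite -gid0; apply: gop_eql fix_y.
by case/negP: c1; rewrite x0 /Zact -[(0, 0)]/(0 : S) lam0l.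
Qed.

Let lamZ a (y : 'F_q) : lam a (0, y) = (0, y).
Proof. by rewrite lam_split lam_Zact Zact1 mul1r. Qed.

(** By [lamZ] both operations agree on Z_q, so (0, n) is the n-th circle power of (0, 1). *)
Let lam_natr n b : lam (0, n%:R) b = iter n (lam (0, 1)) b.
Proof.
elim: n => [|n IH]; first exact: lam0l.
by rewrite iterS -IH -lamM circE lamZ mulrS -[0 in LHS]addr0.
Qed.

Let Mlam : 'M['F_p]_2 :=
  \matrix_(i, j) vec (lam (0, 1) ((j == 0)%:R, (j == 1)%:R, 0)).1 i 0.

Let lamV v : lam (0, 1) (v, 0) = (unvec (Mlam *m vec v), 0).
Proof.
have -> : (v, 0) = (1, 0, 0) *+ v.1 + (0, 1, 0) *+ v.2 :> S.
  rewrite !pairMn !mul0rn !natr_Zp -[RHS]/(v.1 + 0, 0 + v.2, 0 + 0).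
  by rewrite !addr0 add0r; case: v.
rewrite lamD !lamMn [lam _ (1, 0, 0)]surjective_pairing.
rewrite [lam _ (0, 1, 0)]surjective_pairing !lam_fst !pairMn !mul0rn.
set u := (lam _ _).1; set w := (lam _ _).1.
have -> : unvec (Mlam *m vec v) = (u *+ v.1 + w *+ v.2).
  rewrite mulmx_vec vecK !mxE /= -/u -/w; move: u w => [u1 u2] [w1 w2].
  rewrite !pairMn -(mulr_natr u1) -(mulr_natr u2).
  by rewrite -(mulr_natr w1) -(mulr_natr w2) !natr_Zp.
by rewrite -[LHS]/(_, 0 + 0) addr0.
Qed.

Let lam_Mexp n v : lam (0, n%:R) (v, 0) = (unvec (Mlam ^+ n *m vec v), 0).
Proof.
rewrite lam_natr; elim: n => [|n IH]; first by rewrite mul1mx vecK.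
by rewrite iterS IH lamV unvecK exprS mulmxA.
Qed.

Lemma brace_sdop : exists M, [/\ M ^+ q = 1, M != 1 &
  forall x y, gop (sb_circ B) x y = sdop M x y].
Proof.
exists Mlam; split.
- apply: mulmx_vec_inj => u; apply: (can_inj (@unvecK _)).
  (* As q is 0 in Z_q, [Mlam ^+ q] is the action of the neutral element. *)
  have := lam_Mexp q u; rewrite pchar_Fp_0 // lam0l => -[<-].
  by rewrite mul1mx vecK.
(* If [Mlam] were 1, lambda would be trivial and its kernel would have p^2 q elements. *)
- apply: contra_eqN cardK => /eqP M1.
  suff -> : ker_lambda B = setT.
    rewrite cardsT !card_prod !card_Fp // mulnn -[X in _ == X]muln1 eqn_pmul2l.
      by rewrite neq_ltn prime_gt1 ?orbT.
    by rewrite expn_gt0 prime_gt0.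
  apply/setP => a; rewrite [RHS]inE; apply/kerP => -[v z].
  rewrite lam_split -[a.2]natr_Zp lam_natr; elim: (a.2 : nat) => //= n ->.
  by rewrite (pairE v z) lamD lamZ lamV M1 mul1mx vecK.
- move=> x [v z]; rewrite circE lam_split.
  rewrite (pairE v z) lamD lamZ -[X in lam (0, X)]natr_Zp lam_Mexp.
  by rewrite -!pairE /sdop unvecD vecK; case: x.
Qed.

End Classify.
End Semidirect.

(** * The semidirect operation as a group law and as a bi-skew brace *)

Section SemidirectLaw.
Variables (p q : nat) (q_prime : prime q) (M : 'M['F_p]_2) (Mq : M ^+ q = 1).
Local Notation S := ('F_p * 'F_p * 'F_q)%type.
Implicit Types x y z : S.

Let sdinv x : S := (- unvec (M ^+ (- x.2)%R *m vec x.1), - x.2).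

Let expD := expr_FpD q_prime Mq.

Let sdopA : associative (@sdop p q M).
Proof.
move=> x y z; rewrite /sdop !unvecK addrA; congr (_, _).
by rewrite mulmxDr mulmxA addrA expD.
Qed.

Let sdop1l : left_id 0 (@sdop p q M).
Proof.
by case=> v z; rewrite /sdop /= mul1mx -vecD vecK !add0r.
Qed.

Let vec0 : vec 0 = 0 :> 'cV['F_p]_2.
Proof. by apply: (addrI (vec 0)); rewrite -vecD !addr0. Qed.

Let sdop1r : right_id 0 (@sdop p q M).
Proof.
by case=> v z; rewrite /sdop /= vec0 mulmx0 addr0 vecK addr0.
Qed.

Let vecN u : vec (- u) = - vec u :> 'cV['F_p]_2.
Proof. by apply: (addrI (vec u)); rewrite -vecD !subrr vec0. Qed.

Let unvec0 : unvec 0 = 0 :> 'F_p * 'F_p.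
Proof. by rewrite -vec0 vecK. Qed.

Let sdopVl : left_inverse 0 sdinv (@sdop p q M).
Proof.
case=> v z; rewrite /sdop /= vecN unvecK addNr unvec0.
by rewrite addNr.
Qed.

Let sdopVr : right_inverse 0 sdinv (@sdop p q M).
Proof.
case=> v z; rewrite /sdop vecN unvecK mulmxN mulmxA.
rewrite -[M ^+ _ *m _]expD !subrr.
by rewrite [M ^+ _]expr0 mul1mx subrr unvec0.
Qed.

Definition sdlaw : group_law S := GroupLaw sdopA sdop1l sdop1r sdopVl sdopVr.

Lemma sdlaw_brace : brace_axiom (zmod_law S) sdlaw.
Proof.
move=> x y z; rewrite [RHS]surjective_pairing; congr (_, _).
  rewrite -[RHS]/(unvec (vec x.1 + M ^+ x.2 *m vec y.1) - x.1
    + unvec (vec x.1 + M ^+ x.2 *m vec z.1)).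
  rewrite -[(y + z).1]/(y.1 + z.1) vecD mulmxDr !unvecD vecK.
  by rewrite (addrAC x.1) subrr add0r addrCA.
rewrite -[RHS]/(x.2 + y.2 - x.2 + (x.2 + z.2)).
by rewrite (addrAC x.2) subrr add0r addrCA.
Qed.

(** Z_q is abelian, so (x + y) o x^-1 has coordinates x1 + y1 - M^y2 x1 and y2. Composing with x + z
    adds M^y2 (x1 + z1), which cancels the negative term. *)
Lemma sdlaw_bi : brace_axiom sdlaw (zmod_law S).
Proof.
move=> x y z; rewrite -[RHS]/(sdop M (sdop M (x + y) (sdinv x)) (x + z)).
rewrite [LHS]surjective_pairing; congr (_, _).
  rewrite -[LHS]/(x.1 + unvec (vec y.1 + M ^+ y.2 *m vec z.1)).
  rewrite -[RHS]/(unvec (vec (unvec (vec (x.1 + y.1) + M ^+ (x.2 + y.2)%R *m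
    vec (- unvec (M ^+ (- x.2)%R *m vec x.1))))
    + M ^+ (x.2 + y.2 - x.2)%R *m vec (x.1 + z.1))).
  rewrite unvecK vecN unvecK mulmxN mulmxA -[M ^+ _ *m M ^+ _]expD.
  rewrite (addrAC x.2) subrr add0r !vecD mulmxDr.
  by rewrite addrA subrK -[x.1 in LHS]vecK -unvecD addrA.
rewrite -[LHS]/(x.2 + (y.2 + z.2)) -[RHS]/(x.2 + y.2 - x.2 + (x.2 + z.2)).
by rewrite (addrAC x.2) subrr add0r addrCA.
Qed.

End SemidirectLaw.

(** The law is kept as an index of the type, so that different laws on one [T] yield different
    [groupType] instances. *)
Definition law_group (T : Type) (G : group_law T) : Type := T.

HB.instance Definition _ (T : choiceType) (G : group_law T) :=
  Choice.on (law_group G).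
HB.instance Definition _ (T : choiceType) (G : group_law T) :=
  isGroup.Build (law_group G) (gopA G) (gid_l G) (gid_r G)
    (ginv_l G) (ginv_r G).

(** * Exponents in Z_p for group elements *)

Section FpExponentGroup.
Local Open Scope group_scope.
Variables (p : nat) (p_prime : prime p) (G : groupType) (x : G).
Hypothesis xp : x ^+ p = 1.

Lemma expg_Fp_nat n : x ^+ (n%:R : 'F_p)%R = x ^+ n.
Proof.
by rewrite val_Fp_nat // {2}(divn_eq n p) expgnDr mulnC expgnA xp expg1n mul1g.
Qed.

Lemma expg_FpD (a b : 'F_p) : x ^+ (a + b)%R = x ^+ a * x ^+ b.
Proof. by rewrite Fp_addE expg_Fp_nat expgnDr. Qed.

Lemma expg_FpM (a b : 'F_p) : x ^+ (a * b)%R = x ^+ a ^+ b.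
Proof. by rewrite -expgnA -(expg_Fp_nat (muln a b)) natrM !natr_Zp. Qed.

Lemma expg_FpN (a : 'F_p) : x ^+ (- a)%R = (x ^+ a)^-1.
Proof.
by apply: (mulgI (x ^+ a)); rewrite -expg_FpD subrr mulgV.
Qed.
End FpExponentGroup.

(** * Universal property of presented groups *)

Section Words.
Local Open Scope quotient_scope.
Variables (X : choiceType) (R : seq (word X * word X)).
Local Notation P := (law_group (presented_law R)).
Local Open Scope group_scope.

Definition wclass (w : word X) : P := \pi_(presented R) w.

Lemma wclass_cat u v : wclass (u ++ v) = wclass u * wclass v.
Proof. by apply/esym; exact: Defs.pi_mul. Qed.

Lemma wclass_nil : wclass [::] = 1.
Proof. by []. Qed.

Lemma wclass_inv w : wclass (winv w) = (wclass w)^-1.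
Proof.
apply: (mulgI (wclass w)); rewrite mulgV -wclass_cat.
by apply/presentedP; exact: winv_r.
Qed.

Lemma wclass_pow w n : wclass (wpow w n) = wclass w ^+ n.
Proof.
by elim: n => [|n IH]; rewrite ?expg0 // expgS -IH -wclass_cat.
Qed.

Lemma wclass_rel u v : (u, v) \in R -> wclass u = wclass v.
Proof. by move=> uv; apply/presentedP; exact: wcong_rel. Qed.

Variables (H : groupType) (g : X -> H).

Definition weval (w : word X) : H :=
  foldr (fun l acc => (if l.2 then (g l.1)^-1 else g l.1) * acc) 1 w.

Lemma weval_cat u v : weval (u ++ v) = weval u * weval v.
Proof. by elim: u => [|l u IH] /=; rewrite ?mul1g // IH mulgA. Qed.

Lemma weval_inv w : weval (winv w) = (weval w)^-1.
Proof.
elim: w => [|[x b] w IH]; first by rewrite /= invg1.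
rewrite /winv /= rev_cons -cats1 weval_cat -[rev _]/(winv w) IH /= mulg1 invgM.
by case: b; rewrite /= ?invgK.
Qed.

Lemma weval_pow w n : weval (wpow w n) = weval w ^+ n.
Proof.
by elim: n => [|n IH]; rewrite ?expg0 // expgS -IH -weval_cat.
Qed.

Hypothesis gR : forall u v, (u, v) \in R -> weval u = weval v.

Lemma weval_cong u v : wcong R u v -> weval u = weval v.
Proof.
elim=> //.
- by move=> u' v' w' _ -> _ ->.
- by move=> u' u'' v' v'' _ eu _ ev; rewrite !weval_cat eu ev.
- by move=> x [] /=; rewrite mulg1 ?mulVg ?mulgV.
Qed.

(** By [weval_cong] the value does not depend on the chosen representative word. *)
Definition peval (a : P) : H := weval (repr (a : presented R)).

Lemma peval_wclass w : peval (wclass w) = weval w.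
Proof. by apply: weval_cong; exact: wcong_repr. Qed.

Lemma pevalM : {morph peval : a b / a * b}.
Proof.
move=> a b; rewrite -[a]reprK -[b]reprK -wclass_cat !peval_wclass.
exact: weval_cat.
Qed.

Lemma wclass_repr (a : P) : wclass (repr (a : presented R)) = a.
Proof. exact: reprK. Qed.
End Words.

Lemma Fmx_vec p (xi : 'F_p) v :
  unvec (Fmx xi *m vec v) = (- v.2, v.1 - xi * v.2).
Proof.
by rewrite mulmx_vec vecK !mxE eqxx mul0r add0r mulN1r mul1r mulNr.
Qed.

(** * Normal forms in a group satisfying the relations of G_F *)

Section NormalForm.
Local Open Scope group_scope.
Variables (p q : nat) (xi : 'F_p) (p_prime : prime p) (q_prime : prime q).
Variables (G : groupType) (s t e : G).
Hypotheses (sp : s ^+ p = 1) (tp : t ^+ p = 1) (eq1 : e ^+ q = 1).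
Hypotheses (st : commute s t) (es : e * s = t * e).
Hypothesis et : e * t = s^-1 * (t ^+ xi)^-1 * e.
Implicit Types u v : ('F_p * 'F_p)%type.

Definition normal_form (x : 'F_p * 'F_p * 'F_q) : G :=
  s ^+ x.1.1 * t ^+ x.1.2 * e ^+ x.2.

Let rho v : G := s ^+ v.1 * t ^+ v.2.

Let rhoD u v : rho (u + v)%R = rho u * rho v.
Proof.
rewrite /rho /= !(expg_FpD p_prime) // !mulgA; congr (_ * _).
by rewrite -!mulgA; congr (_ * _); exact: commuteX2.
Qed.

Let e_exp (x y : G) n : e * x = y * e -> e * x ^+ n = y ^+ n * e.
Proof.
move=> exy; elim: n => [|n IH]; first by rewrite mul1g mulg1.
by rewrite !expgS mulgA exy -mulgA IH mulgA.
Qed.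

(** Conjugation by [e] sends s to t and t to s^-1 t^-xi; these exponents are the columns of F. *)
Let e_rho v : e * rho v = rho (unvec (Fmx xi *m vec v)) * e.
Proof.
rewrite mulgA (e_exp _ es) -[LHS]mulgA (e_exp _ et) mulgA; congr (_ * _).
rewrite Fmx_vec -[RHS]/(s ^+ (- v.2)%R * t ^+ (v.1 - xi * v.2)%R).
rewrite !(expg_FpD p_prime) // !(expg_FpN p_prime) //.
rewrite (expg_FpM p_prime) // expgMn; last first.
  by apply/commuteV/commute_sym/commuteV/commute_sym/commuteX.
rewrite !expVgn !mulgA; congr (_ * _).
by apply/commuteV/commute_sym/commuteX2.
Qed.

Let e_exp_rho n v :
  e ^+ n * rho v = rho (unvec ((Fmx xi ^+ n)%R *m vec v)) * e ^+ n.
Proof.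
elim: n v => [|n IH] v; first by rewrite mul1mx vecK mul1g mulg1.
rewrite expgSr -mulgA e_rho mulgA IH unvecK mulmxA -[_ *m Fmx xi]exprSr.
by rewrite -mulgA -expgSr.
Qed.

Lemma normal_formM x y :
  normal_form (sdop (Fmx xi) x y) = normal_form x * normal_form y.
Proof.
rewrite -[LHS]/(rho (unvec (vec x.1 + Fmx xi ^+ x.2 *m vec y.1))%R *
  e ^+ (x.2 + y.2)%R) -[RHS]/(rho x.1 * e ^+ x.2 * (rho y.1 * e ^+ y.2)).
rewrite unvecD vecK rhoD (expg_FpD q_prime) //.
by rewrite [RHS]mulgA -[X in _ = X * _]mulgA e_exp_rho !mulgA.
Qed.

End NormalForm.

(** * The semidirect group is presented by the relations of G_F *)

Section PresentationIso.
Variables (p q : nat) (xi : 'F_p) (p_prime : prime p) (q_prime : prime q).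
Hypothesis Fq : Fmx xi ^+ q = 1.
Local Notation S := ('F_p * 'F_p * 'F_q)%type.
Local Notation G := (law_group (GF_law q xi)).
Local Notation H := (law_group (sdlaw q_prime Fq)).
Local Notation cls := (@wclass _ (GF_rels q xi)).

Let mulE (x y : H) : (x * y)%g = sdop (Fmx xi) x y. Proof. by []. Qed.

Let mul_trans (u : 'F_p * 'F_p) (x : S) :
  (((u, 0) : H) * (x : H))%g = (u + x.1, x.2) :> H.
Proof. by rewrite mulE /sdop /= mul1mx -vecD vecK add0r. Qed.

Let exp_trans (u : 'F_p * 'F_p) n : (((u, 0) : H) ^+ n)%g = (u *+ n, 0) :> H.
Proof. by elim: n => [|n IH]; rewrite ?expg0 // expgS IH mul_trans mulrS. Qed.

Let mul_rot (c : 'F_q) (x : S) :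
  (((0, 0, c) : H) * (x : H))%g =
    (unvec (Fmx xi ^+ c *m vec x.1), c + x.2) :> H.
Proof.
rewrite mulE /sdop unvecD vecK.
by rewrite -[(0, 0, c).1]/(0 : 'F_p * 'F_p) add0r.
Qed.

(* Under %g, a bare 1 in 'F_q would denote the unit of its additive group. *)
Let exp_rot n : (((0, 0, 1)%R : H) ^+ n)%g = (0, 0, n%:R) :> H.
Proof.
elim: n => [|n IH]; rewrite ?expg0 // expgS IH mul_rot mulrS.
by rewrite mulmx_vec vecK !mulr0 addr0.
Qed.

Let inv_trans (u : 'F_p * 'F_p) : ((u, 0) : H)^-1%g = (- u, 0) :> H.
Proof.
by apply: (mulgI ((u, 0) : H)); rewrite mulgV mul_trans subrr.
Qed.

Let inv_rot : ((0, 0, 1)%R : H)^-1%g = (0, 0, -1) :> H.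
Proof.
apply: (mulgI ((0, 0, 1)%R : H)); rewrite mulgV mul_rot.
by rewrite mulmx_vec vecK !mulr0 addr0; congr (_, _); exact/esym/subrr.
Qed.

Definition GF_gen (i : 'I_3) : H :=
  if i == sigma then (1, 0, 0) else if i == tau then (0, 1, 0) else (0, 0, 1).

Let genS : GF_gen sigma = (1, 0, 0). Proof. by []. Qed.
Let genT : GF_gen tau = (0, 1, 0). Proof. by []. Qed.
Let genE : GF_gen eps = (0, 0, 1). Proof. by []. Qed.

Let weval_gen i : weval GF_gen (wgen i) = GF_gen i.
Proof. exact: mulg1. Qed.

(** This makes [peval GF_gen] a homomorphism from the presented group to the semidirect one. *)
Lemma GF_gen_rels u v :
  (u, v) \in GF_rels q xi -> weval GF_gen u = weval GF_gen v.
Proof.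
rewrite /GF_rels !in_cons in_nil orbF !xpair_eqE.
case/orP=> [|/orP[|/orP[|/orP[|/orP[|]]]]] /andP[/eqP -> /eqP ->];
  rewrite ?weval_cat ?weval_inv ?weval_pow ?weval_gen ?genS ?genT ?genE.
- by rewrite exp_trans pairMn pchar_Fp_0 // mul0rn.
- by rewrite exp_trans pairMn pchar_Fp_0 // mul0rn.
- by rewrite exp_rot pchar_Fp_0.
- have st : commute ((1, 0, 0) : H)%R ((0, 1, 0) : H)%R.
    by rewrite /commute !mul_trans addrC.
  by rewrite mulgA -invgM st mulgV.
- rewrite inv_rot mul_trans mul_rot.
  rewrite -[(0, 0, -1).1]/(0 : 'F_p * 'F_p) addr0 Fmx_vec.
  by rewrite mulr0 subr0 oppr0 subrr.
- rewrite exp_trans !inv_trans inv_rot !mul_trans mul_rot.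
  rewrite -[(0, 0, -1).1]/(0 : 'F_p * 'F_p) addr0 Fmx_vec pairMn mul0rn natr_Zp.
  rewrite -[RHS]/(- 1 - 0, - 0 - xi, 0) -[LHS]/(- 1, 0 - xi * 1, 1 - 1).
  by rewrite mulr1 subr0 oppr0 subrr.
Qed.

Let GF_rel_mem (i : nat) : (i < 6)%N ->
  nth ([::], [::]) (GF_rels q xi) i \in GF_rels q xi.
Proof. by move=> i6; exact: mem_nth. Qed.

Lemma presentation_iso : group_iso (sdlaw q_prime Fq) (GF_law q xi).
Proof.
pose s : G := cls (wgen sigma); pose t : G := cls (wgen tau).
pose e : G := cls (wgen eps).
have relE u v : (u, v) \in GF_rels q xi -> cls u = cls v by exact: wclass_rel.
have sp : (s ^+ p = 1)%g.
  by have /relE := @GF_rel_mem 0%N isT; rewrite wclass_pow.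
have tp : (t ^+ p = 1)%g.
  by have /relE := @GF_rel_mem 1%N isT; rewrite wclass_pow.
have eq1 : (e ^+ q = 1)%g.
  by have /relE := @GF_rel_mem 2%N isT; rewrite wclass_pow.
have st : commute s t.
  have /relE := @GF_rel_mem 3%N isT.
  rewrite !wclass_cat !wclass_inv -/s -/t => E.
  by apply: (mulIg (t * s)^-1%g); rewrite mulgV invgM -mulgA.
have es : (e * s = t * e)%g.
  have /relE := @GF_rel_mem 4%N isT.
  rewrite !wclass_cat !wclass_inv -/s -/t -/e => <-.
  by rewrite -!mulgA mulVg mulg1.
have et : (e * t = s^-1 * (t ^+ xi)^-1 * e)%g.
  have /relE := @GF_rel_mem 5%N isT.
  rewrite !wclass_cat !wclass_inv wclass_pow -/s -/t -/e => <-.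
  by rewrite -!mulgA mulVg mulg1.
pose f (x : S) : G := normal_form s t e x.
have fM x y : f (sdop (Fmx xi) x y) = (f x * f y)%g by exact: normal_formM.
exists f => //.
(* The homomorphism induced by the generators is the inverse of the normal form map. *)
pose psi : G -> H := peval GF_gen.
have psiM a b : psi (a * b)%g = (psi a * psi b)%g.
  by apply: pevalM; exact: GF_gen_rels.
have psi1 : psi 1%g = 1%g.
  by rewrite /psi -(wclass_nil (GF_rels q xi)) (peval_wclass GF_gen_rels).
have psiX a n : psi (a ^+ n)%g = (psi a ^+ n)%g.
  by elim: n => [|n IH]; rewrite ?expg0 // !expgS psiM IH.
have psi_gen i : psi (cls (wgen i)) = GF_gen i.
  by rewrite /psi peval_wclass ?weval_gen //; exact: GF_gen_rels.
exists psi.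
- case=> -[a b] c; rewrite /f /normal_form !psiM !psiX.
  rewrite !psi_gen genS genT genE !exp_trans exp_rot !mul_trans !pairMn.
  rewrite -[LHS]/(a%:R + 0 *+ b + 0, 0 *+ a + b%:R + 0, c%:R).
  by rewrite !natr_Zp !mul0rn !addr0 add0r.
- have f1 : f 0 = 1%g by rewrite /f /normal_form !expg0 !mulg1.
  have gen i : f (GF_gen i) = cls (wgen i).
    have [->|[->|->]] : i = sigma \/ i = tau \/ i = eps.
      case: i => [[|[|[|//]]] hi]; [left | right; left | right; right];
        exact: val_inj.
    + by rewrite genS /f /normal_form !expg0 !mulg1.
    + by rewrite genT /f /normal_form !expg0 mulg1 mul1g.
    + by rewrite genE /f /normal_form !expg0 !mul1g.
  have fV (x : H) : f (x^-1)%g = ((f x)^-1)%g.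
    by apply: (mulgI (f x)); rewrite -fM -mulE !mulgV; exact: f1.
  (* The composite is multiplicative and fixes the generators, so induction on a word representing
     [x] suffices. *)
  move=> x; rewrite -[RHS]wclass_repr /psi /peval.
  elim: (repr _) => [|[i b] w IH]; first exact: f1.
  rewrite -cat1s weval_cat wclass_cat fM IH; congr (_ * _)%g.
  case: b; last by rewrite weval_gen gen.
  rewrite -[[:: _]]/(winv (wgen i)) weval_inv weval_gen.
  by rewrite fV gen wclass_inv.
Qed.
End PresentationIso.

(** * The kernel of lambda in the semidirect brace *)

Section Kernel.
Variables (p q : nat) (p_prime : prime p) (q_prime : prime q).
Variables (M : 'M['F_p]_2) (Mq : M ^+ q = 1).
Local Notation S := ('F_p * 'F_p * 'F_q)%type.

(** Here lambda_a is M^(a.2) on the plane and the identity on Z_q, hence trivial exactly when a.2 =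
    0. *)
Lemma card_ker_sdlaw : (forall k, (0 < k < q)%N -> M ^+ k != 1) ->
  #|ker_lambda (SkewBrace (sdlaw_brace q_prime Mq) : skew_brace S)| = (p ^ 2)%N.
Proof.
move=> Mk; rewrite -(card_snd0 q p_prime); apply: eq_card => a.
have lamE b : sb_lambda (SkewBrace (sdlaw_brace q_prime Mq)) a b =
    (unvec (M ^+ a.2 *m vec b.1), b.2).
  apply: (addrI (a : S)); rewrite /sb_lambda /= addrA subrr add0r.
  by rewrite /sdop unvecD vecK; case: (a).
rewrite !inE; apply/forallP/idP => [ha|/eqP a0 b]; last first.
  by rewrite lamE a0 mul1mx vecK; case: (b).
apply: contraT => a0; suff M1 : M ^+ a.2 = 1.
  have ak : (0 < a.2 < q)%N.
    by rewrite lt0n a0 -[X in (_ < X)%N](Fp_cast q_prime) /=.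
  by move: (Mk _ ak); rewrite M1 eqxx.
apply: mulmx_vec_inj => u; have /eqP := ha (u, 0).
rewrite lamE => /(congr1 fst) /= e.
by rewrite mul1mx -{2}e unvecK.
Qed.
End Kernel.

(** Fermat gives c^p = c, so c^2 = c^(p+1) is a power of c^q = 1. As q is odd, c^q = c. *)
Lemma Fp_root1 p q (c : 'F_p) : prime p -> odd q -> (q %| p.+1)%N ->
  c ^+ q = 1 -> c = 1.
Proof.
move=> p_prime q_odd /dvdnP[m em] cq.
have cp : c ^+ p = c.
  rewrite -[c]natr_Zp -natrX; apply: val_inj; rewrite /= !val_Fp_nat //.
  exact: fermat_little.
have c2 : c ^+ 2 = 1.
  by rewrite -[LHS]/(c * c) -{1}cp -exprSr em mulnC exprM cq expr1n.
by rewrite -cq -(odd_double_half q) q_odd exprS -mul2n exprM c2 expr1n mulr1.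
Qed.

Theorem lemma4p2 (p q : nat) (p_prime : prime p) (q_prime : prime q)
    (p_odd : odd p) (q_odd : odd q)
    (p_mod_q : (p%:Z = -1 %[mod q%:Z])%Z)
    (xi : 'F_p)
    (xi_irr : irreducible_poly ('X^2 + xi *: 'X + 1 : {poly 'F_p}))
    (F_order : #[F_GL xi]%g = q) :
  exists B : skew_brace (BF p q),
    [/\ [/\ left_brace B,
            group_iso (sb_add B) (zmod_law ('F_p * 'F_p * 'F_q)%type) &
            #|ker_lambda B| = (p ^ 2)%N],
        forall (T : finType) (B' : skew_brace T),
          left_brace B' ->
          group_iso (sb_add B') (zmod_law ('F_p * 'F_p * 'F_q)%type) ->
          #|ker_lambda B'| = (p ^ 2)%N ->
          brace_iso B' B,
        (forall x y : BF p q, gop (sb_add B) x y = BF_add x y) /\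
        (forall x y : BF p q, gop (sb_circ B) x y = BF_circ xi x y),
        group_iso (sb_circ B) (GF_law q xi) &
        bi_skew_brace B].
Proof.
have q_dvd : (q %| p.+1)%N.
  have /eqP := p_mod_q; rewrite eqz_mod_dvd opprK -PoszD addn1.
  by rewrite dvdzE.
have q_ndvd : ~~ (q %| p)%N.
  apply/negP => qp; move: q_dvd; rewrite -addn1 dvdn_addr // dvdn1 => /eqP q1.
  by rewrite q1 in q_prime.
have pq : coprime p q by rewrite coprime_sym prime_coprime.
have FX n : Fmx xi ^+ n = val (F_GL xi ^+ n)%g by rewrite FinRing.val_unitX.
have Fq : Fmx xi ^+ q = 1 by rewrite FX -F_order expg_order.
have Fk k : (0 < k < q)%N -> Fmx xi ^+ k != 1.
  move=> /andP[k0 kq]; rewrite FX -[1]/(val (1%g : {'GL_2['F_p]})).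
  rewrite (inj_eq val_inj) -order_dvdn F_order; apply/negP => /dvdn_leq.
  by lia.
have qK : q%:R != 0 :> 'F_p.
  rewrite -(dvdn_pcharf (pchar_Fp p_prime)) -prime_coprime //.
have rootK c : c ^+ q = 1 -> c = 1 :> 'F_p by exact: Fp_root1.
exists (SkewBrace (sdlaw_brace q_prime Fq)); split.
- split.
  + exact: addrC.
  + by exists id => //; exists id.
  + exact: card_ker_sdlaw.
(* Uniqueness: transport B' to the standard additive group, read off its matrix M, conjugate M to a
   power of F, and compose the two isomorphisms. *)
- move=> T B' _ [f f_bij fD] cardK.
  have [C addC [cardC [g [g_bij gD gM]]]] := transport_brace f_bij fD.
  have [|M [Mq M1 CM]] := brace_sdop q_prime p_prime addC _ pq.
    by rewrite cardC.
  have [k kq [P uP ePM]] := root_conj_pow q_odd qK rootK Mq M1 Fq Fk.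
  have [h [h_bij hD hM]] := sdop_conj q_prime Mq Fq kq uP ePM.
  exists (h \o g); split; first exact: bij_comp.
    by move=> x y; rewrite /= gD addC hD.
  by move=> x y; rewrite /= gM CM hM.
- split; first by move=> [[x1 x2] x3] [[y1 y2] y3].
  by move=> [[x1 x2] x3] [[y1 y2] y3].
- exact: presentation_iso.
- exact: sdlaw_bi.
Qed.
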